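(* Let $a_i,b_i,c_i,k_i\in\mathbb R$ $(i=1,2,3)$, put $A_i=(a_i,b_i,c_i)\in\mathbb R^3$, and let $$\varphi(x,y,z)=(a_1x+b_1y+c_1z+k_1,\;a_2x+b_2y+c_2z+k_2,\;a_3x+b_3y+c_3z+k_3).$$ Let $(p_1,\dots,p_9)\in\mathbb R^9$ be a solution $(x_1,\dots,x_9)=(p_1,\dots,p_9)$ of the system $$\begin{aligned} -x_1x_4+x_2x_3-x_2x_6+x_4^2-x_7&=0,\\ x_2x_5-x_3x_4-x_8&=0,\\ -x_1x_5+x_3^2-x_3x_6+x_4x_5-x_9&=0,\\ \|A_2\|^2x_1+2(A_2\cdot A_3)x_3+\|A_3\|^2x_5&=-2(A_1\cdot A_2),\\ \|A_2\|^2x_2+2(A_2\cdot A_3)x_4+\|A_3\|^2x_6&=-2(A_1\cdot A_3),\\ \|A_2\|^2x_7+2(A_2\cdot A_3)x_8+\|A_3\|^2x_9&=-\|A_1\|^2, \end{aligned}$$ where $\cdot$ and $\|\cdot\|$ are the Euclidean inner product and norm of $\mathbb R^3$. Then the algebra $\mathbb A=\mathbb A^3_1(p_1,\dots,p_6)$ is $\varphi$-harmonic.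
   Context: For real $p_1,\dots,p_6$, the algebra $\mathbb A^3_1(p_1,\dots,p_6)$ is $\mathbb R^3$ with canonical basis $e_1,e_2,e_3$ and the commutative bilinear product $\ast$ with identity $e=e_1$ given by $$e_2\ast e_2=p_7e_1+p_1e_2+p_2e_3,\quad e_2\ast e_3=p_8e_1+p_3e_2+p_4e_3,\quad e_3\ast e_3=p_9e_1+p_5e_2+p_6e_3,$$ where $p_7=-p_1p_4+p_2p_3-p_2p_6+p_4^2$, $p_8=p_2p_5-p_3p_4$, $p_9=-p_1p_5+p_3^2-p_3p_6+p_4p_5$ (these identities guarantee associativity). For an affine map $\varphi:\mathbb R^3\to\mathbb A$, the algebra $\mathbb A$ is called $\varphi$-harmonic if $\varphi_x^2+\varphi_y^2+\varphi_z^2=0$, where $\varphi_x=d\varphi(e_1)$, $\varphi_y=d\varphi(e_2)$, $\varphi_z=d\varphi(e_3)$ are the partial derivatives (constant vectors of $\mathbb A$) and squares are taken with respect to the product of $\mathbb A$. *)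

(* Defs.v *)
From HB Require Import structures.
From mathcomp Require Import all_boot all_order all_algebra.
From mathcomp Require Import ring.
From mathcomp Require Import all_classical all_reals all_analysis.

Set Implicit Arguments.
Unset Strict Implicit.
Unset Printing Implicit Defensive.

Import Order.TTheory GRing.Theory Num.Theory.
Import numFieldNormedType.Exports.
Local Open Scope ring_scope.

(* Coordinates are 0-based: the canonical basis vectors e_1, e_2, e_3 of R^3
   are [basis3 R 0], [basis3 R 1], [basis3 R 2]. *)
Definition basis3 (R : realType) (i : 'I_3) : 'rV[R]_3 := delta_mx 0 i.

Definition vec3 (R : realType) (x y z : R) : 'rV[R]_3 :=
  x *: basis3 R 0 + y *: basis3 R 1 + z *: basis3 R 2.

Definition dot (R : realType) (n : nat) (u v : 'rV[R]_n) : R :=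
  \sum_(i < n) u 0 i * v 0 i.

(* The norm [`|u|] of MathComp-Analysis on row vectors is the sup norm. *)
Definition enorm (R : realType) (n : nat) (u : 'rV[R]_n) : R :=
  Num.sqrt (dot u u).

Definition affine3 (R : realType)
    (a1 a2 a3 b1 b2 b3 c1 c2 c3 k1 k2 k3 : R) (u : 'rV[R]_3) : 'rV[R]_3 :=
  let x := u 0 0 in let y := u 0 1 in let z := u 0 2 in
  vec3 (a1 * x + b1 * y + c1 * z + k1)
       (a2 * x + b2 * y + c2 * z + k2)
       (a3 * x + b3 * y + c3 * z + k3).

(* The product [e_(i+1) * e_(j+1)] of two canonical basis vectors. *)
Definition alg31_table (R : realType) (p1 p2 p3 p4 p5 p6 : R) (i j : 'I_3) :
    'rV[R]_3 :=
  let p7 := - p1 * p4 + p2 * p3 - p2 * p6 + p4 ^+ 2 in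
  let p8 := p2 * p5 - p3 * p4 in
  let p9 := - p1 * p5 + p3 ^+ 2 - p3 * p6 + p4 * p5 in
  match val i, val j with
  | 0%N, _ => basis3 R j
  | _, 0%N => basis3 R i
  | 1%N, 1%N => vec3 p7 p1 p2
  | 1%N, _ | _, 1%N => vec3 p8 p3 p4
  | _, _ => vec3 p9 p5 p6
  end.

Definition alg31_mul (R : realType) (p1 p2 p3 p4 p5 p6 : R)
    (u v : 'rV[R]_3) : 'rV[R]_3 :=
  \sum_(i < 3) \sum_(j < 3)
    (u 0 i * v 0 j) *: alg31_table p1 p2 p3 p4 p5 p6 i j.

(* The algebra is R^3 as a normed space, with the ring structure declared
   below (product [alg31_mul], identity [basis3 R 0]). *)
Definition alg31 (R : realType) (p1 p2 p3 p4 p5 p6 : R) : Type := 'rV[R]_3.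

Section Alg31.
Variables (R : realType) (p1 p2 p3 p4 p5 p6 : R).

Local Notation A := (alg31 p1 p2 p3 p4 p5 p6).
Local Notation mul := (@alg31_mul R p1 p2 p3 p4 p5 p6).

Lemma vec3E (x y z : R) (i : 'I_3) :
  vec3 x y z 0 i = if val i is 0%N then x else if val i is 1%N then y else z.
Proof.
by rewrite !mxE; case: i => [[|[|[|//]]] ?] /=; rewrite ?(mulr1, mulr0, addr0, add0r).
Qed.

Lemma alg31_mulE (u v : 'rV[R]_3) :
  mul u v = vec3
   (u 0 0 * v 0 0
     + (- p1 * p4 + p2 * p3 - p2 * p6 + p4 ^+ 2) * (u 0 1 * v 0 1)
     + (p2 * p5 - p3 * p4) * (u 0 1 * v 0 2 + u 0 2 * v 0 1)
     + (- p1 * p5 + p3 ^+ 2 - p3 * p6 + p4 * p5) * (u 0 2 * v 0 2))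
   (u 0 0 * v 0 1 + u 0 1 * v 0 0 + p1 * (u 0 1 * v 0 1)
     + p3 * (u 0 1 * v 0 2 + u 0 2 * v 0 1) + p5 * (u 0 2 * v 0 2))
   (u 0 0 * v 0 2 + u 0 2 * v 0 0 + p2 * (u 0 1 * v 0 1)
     + p4 * (u 0 1 * v 0 2 + u 0 2 * v 0 1) + p6 * (u 0 2 * v 0 2)).
Proof.
have E1 : lift ord0 ord0 = 1 :> 'I_3 by exact: val_inj.
have E2 : lift ord0 (lift ord0 ord0) = 2 :> 'I_3 by exact: val_inj.
apply/rowP => k; rewrite /alg31_mul !big_ord_recl !big_ord0 !E1 !E2 /alg31_table /= vec3E !mxE.
by case: k => [[|[|[|//]]] ?] /=; ring.
Qed.

Lemma alg31_mulC : commutative mul.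
Proof. by move=> u v; rewrite !alg31_mulE; congr vec3; ring. Qed.

Lemma alg31_mulA : associative mul.
Proof. by move=> u v w; rewrite !alg31_mulE !vec3E /=; congr vec3; ring. Qed.

Lemma alg31_mul1 : left_id (basis3 R 0) mul.
Proof.
move=> u; apply/rowP => k; rewrite alg31_mulE vec3E !mxE.
have [|[|]] : k = 0 \/ k = 1 \/ k = 2; last 3 first.
- by move=> -> /=; ring.
- by move=> -> /=; ring.
- by move=> -> /=; ring.
case: k => [[|[|[|//]]] ?]; [left|right; left|right; right]; exact: val_inj.
Qed.

Lemma alg31_mulDl : left_distributive mul +%R.
Proof.
move=> u v w; apply/rowP => k; rewrite mxE !alg31_mulE !vec3E !mxE.
by case: k => [[|[|[|//]]] ?] /=; ring.
Qed.

Lemma alg31_one_neq0 : basis3 R 0 != 0.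
Proof.
by apply/eqP => /rowP /(_ 0); rewrite !mxE /=; apply/eqP; exact: oner_neq0.
Qed.

Lemma alg31_scalerAl (k : R) (u v : 'rV[R]_3) :
  k *: mul u v = mul (k *: u) v.
Proof.
apply/rowP => i; rewrite mxE !alg31_mulE !vec3E !mxE.
by case: i => [[|[|[|//]]] ?] /=; ring.
Qed.

HB.instance Definition _ := NormedModule.copy A 'rV[R]_3.
HB.instance Definition _ := GRing.Zmodule_isComNzRing.Build A
  alg31_mulA alg31_mulC alg31_mul1 alg31_mulDl alg31_one_neq0.
HB.instance Definition _ := GRing.Lmodule_isLalgebra.Build R A alg31_scalerAl.
HB.instance Definition _ := GRing.Lalgebra_isComAlgebra.Build R A.

End Alg31.

(* For an affine [phi] the differential ['d phi u] does not depend on the base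
   point [u], and its values at the basis vectors are the partial derivatives.
   Squares are taken in the ring structure of [alg31]. *)
Definition phi_harmonic (R : realType) (p1 p2 p3 p4 p5 p6 : R)
    (phi : 'rV[R]_3 -> alg31 p1 p2 p3 p4 p5 p6) : Prop :=
  forall u : 'rV[R]_3,
    ('d phi u (basis3 R 0)) ^+ 2 + ('d phi u (basis3 R 1)) ^+ 2
      + ('d phi u (basis3 R 2)) ^+ 2 = 0.
Arguments phi_harmonic {R} p1 p2 p3 p4 p5 p6 phi.

(* Main.v *)
Require Import Defs.
From HB Require Import structures.
From mathcomp Require Import all_boot all_order all_algebra.
From mathcomp Require Import ring.
From mathcomp Require Import all_classical all_reals all_analysis.
Import Order.TTheory GRing.Theory Num.Theory.
Import numFieldNormedType.Exports.
Local Open Scope ring_scope.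

(** The partial derivatives of [phi] are the columns (a1, a2, a3), (b1, b2, b3), (c1, c2, c3) of its
    linear part ([diff_affine3]). The coordinates of a square in the algebra are quadratic forms in
    the coordinates of the vector ([alg31_sqr]). Summing such a form over the three columns turns
    each monomial into an inner product of the rows A1, A2, A3: the sum of y^2 is |A2|^2, that of y
    z is A2.A3, and so on. The three coordinates of the sum of squares are thus |A1|^2 + p7 |A2|^2 +
    2 p8 A2.A3 + p9 |A3|^2 and its two analogues, and the last three equations of the system say
    that they vanish; the first three identify p7, p8, p9 with the structure constants of the
    product. *)

(** The map is a continuous linear map plus a constant. The target [W] is arbitrary so that it can
    be the algebra [alg31] itself. *)
Lemma diff_row_affine (R : realType) (n : nat) (W : normedModType R)
    (w : 'I_n -> W) (k : W) (u v : 'rV[R]_n) :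
  'd (fun x : 'rV[R]_n => \sum_(i < n) x 0 i *: w i + k) u v
    = \sum_(i < n) v 0 i *: w i.
Proof.
pose L (x : 'rV[R]_n) : W := \sum_(i < n) x 0 i *: w i.
have Llin : linear L.
  move=> a x y; rewrite /L scaler_sumr -big_split /=.
  by apply: eq_bigr => i _; rewrite !mxE scalerDl scalerA.
pose LM := GRing.isLinear.Build _ _ _ _ _ Llin.
pose LL : {linear 'rV[R]_n -> W} := HB.pack L LM.
have Lcont : continuous LL.
  apply: continuous_big => [|i _ x]; first exact: add_continuous.
  apply: (@continuous_comp _ _ _ (fun y : 'rV[R]_n => y 0 i) ( *:%R ^~ (w i))).
    exact: coord_continuous.
  exact: scalel_continuous.
have dL : differentiable LL u by exact: linear_differentiable.
rewrite (_ : (fun x => _) = (LL : _ -> W) + cst k); last by [].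
by rewrite diffD ?diff_cst ?diff_lin //= ?addr0 //; exact: differentiable_cst.
Qed.

Lemma enorm_sqr (R : realType) (n : nat) (u : 'rV[R]_n) :
  enorm u ^+ 2 = dot u u.
Proof.
by rewrite sqr_sqrtr //; apply: sumr_ge0 => i _; rewrite -expr2 sqr_ge0.
Qed.

Lemma sum_ord3 (V : nmodType) (F : 'I_3 -> V) :
  \sum_(i < 3) F i = F 0 + F 1 + F 2.
Proof.
by rewrite !big_ord_recr big_ord0 /= add0r; congr (F _ + F _ + F _); exact: val_inj.
Qed.

Lemma dot_vec3 (R : realType) (x y z x' y' z' : R) :
  dot (vec3 x y z) (vec3 x' y' z') = x * x' + y * y' + z * z'.
Proof. by rewrite /dot sum_ord3 !vec3E. Qed.

Lemma diff_affine3 (R : realType) (p1 p2 p3 p4 p5 p6 : R)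
    (a1 a2 a3 b1 b2 b3 c1 c2 c3 k1 k2 k3 : R) (u v : 'rV[R]_3) :
  'd (affine3 a1 a2 a3 b1 b2 b3 c1 c2 c3 k1 k2 k3
        : 'rV[R]_3 -> alg31 p1 p2 p3 p4 p5 p6) u v
    = affine3 a1 a2 a3 b1 b2 b3 c1 c2 c3 0 0 0 v.
Proof.
pose w (i : 'I_3) : alg31 p1 p2 p3 p4 p5 p6 :=
  match val i with
  | 0%N => vec3 a1 a2 a3
  | 1%N => vec3 b1 b2 b3
  | _ => vec3 c1 c2 c3
  end.
(* The translation is left general because [E] is used twice: with zero translation for the
   right-hand side, and with k1, k2, k3 for the map being differentiated. *)
have E l1 l2 l3 (x : 'rV[R]_3) :
    affine3 a1 a2 a3 b1 b2 b3 c1 c2 c3 l1 l2 l3 x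
      = (\sum_(i < 3) x 0 i *: w i + vec3 l1 l2 l3 :> alg31 p1 p2 p3 p4 p5 p6).
  rewrite sum_ord3 /w /=; apply/rowP => j.
  rewrite vec3E !mxE.
  by case: j => [[|[|[|//]]] ?] /=; ring.
rewrite E (_ : affine3 _ _ _ _ _ _ _ _ _ k1 k2 k3 = fun x : 'rV[R]_3 =>
    (\sum_(i < 3) x 0 i *: w i + vec3 k1 k2 k3 : alg31 p1 p2 p3 p4 p5 p6)).
  by rewrite diff_row_affine /vec3 !scale0r !addr0.
by apply/funext => x; exact: E.
Qed.

(** By commutativity the mixed terms pair up, whence the factors 2. The structure constants stay
    expanded, in the shape of the first three equations of the system. *)
Lemma alg31_sqr (R : realType) (p1 p2 p3 p4 p5 p6 x y z : R) :
  (vec3 x y z : alg31 p1 p2 p3 p4 p5 p6) ^+ 2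
    = vec3
        (x ^+ 2 + (- p1 * p4 + p2 * p3 - p2 * p6 + p4 ^+ 2) * y ^+ 2
          + 2 * (p2 * p5 - p3 * p4) * (y * z)
          + (- p1 * p5 + p3 ^+ 2 - p3 * p6 + p4 * p5) * z ^+ 2)
        (2 * (x * y) + p1 * y ^+ 2 + 2 * p3 * (y * z) + p5 * z ^+ 2)
        (2 * (x * z) + p2 * y ^+ 2 + 2 * p4 * (y * z) + p6 * z ^+ 2).
Proof.
rewrite expr2 [LHS]alg31_mulE !vec3E /=; congr vec3; ring.
Qed.

Theorem proposition2p1 (R : realType)
    (a1 a2 a3 b1 b2 b3 c1 c2 c3 k1 k2 k3 : R)
    (p1 p2 p3 p4 p5 p6 p7 p8 p9 : R) :
  let A1 := vec3 a1 b1 c1 in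
  let A2 := vec3 a2 b2 c2 in
  let A3 := vec3 a3 b3 c3 in
  - p1 * p4 + p2 * p3 - p2 * p6 + p4 ^+ 2 - p7 = 0 ->
  p2 * p5 - p3 * p4 - p8 = 0 ->
  - p1 * p5 + p3 ^+ 2 - p3 * p6 + p4 * p5 - p9 = 0 ->
  enorm A2 ^+ 2 * p1 + 2 * dot A2 A3 * p3 + enorm A3 ^+ 2 * p5
    = - 2 * dot A1 A2 ->
  enorm A2 ^+ 2 * p2 + 2 * dot A2 A3 * p4 + enorm A3 ^+ 2 * p6
    = - 2 * dot A1 A3 ->
  enorm A2 ^+ 2 * p7 + 2 * dot A2 A3 * p8 + enorm A3 ^+ 2 * p9
    = - enorm A1 ^+ 2 ->
  phi_harmonic p1 p2 p3 p4 p5 p6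
    (affine3 a1 a2 a3 b1 b2 b3 c1 c2 c3 k1 k2 k3).
Proof.
move=> A1 A2 A3 /subr0_eq E7 /subr0_eq E8 /subr0_eq E9.
rewrite !enorm_sqr !dot_vec3 => H2 H3 H1 u.
(* Evaluating the linear part at the basis vectors leaves its three columns. *)
rewrite !diff_affine3 /affine3 !mxE /= !(mulr1, mulr0, addr0, add0r).
rewrite !alg31_sqr E7 E8 E9; apply/rowP => j.
(* With abstract summands, [mxE] splits the sum without unfolding the [vec3] terms. *)
have -> (x y z : alg31 p1 p2 p3 p4 p5 p6) :
  (x + y + z) 0 j = x 0 j + y 0 j + z 0 j by rewrite !mxE.
rewrite !vec3E [RHS]mxE.
case: j => [[|[|[|//]]] ?] /=.
(* In each coordinate the 0 of the goal is replaced by the difference of the two sides of the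
   matching equation, which leaves a polynomial identity. *)
- move/eqP: H1; rewrite -subr_eq0 => /eqP <-; ring.
- move/eqP: H2; rewrite -subr_eq0 => /eqP <-; ring.
- move/eqP: H3; rewrite -subr_eq0 => /eqP <-; ring.
Qed.
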